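(* There exists a binary linear $[4096,772,1024]$ code, and there exists a lattice of dimension $4096$ with center density at least $2^{11529}$.
   Context: A binary linear $[N,k,d]$ code is a $k$-dimensional subspace of ${\bf F}_2^N$ with minimum nonzero Hamming weight $d$. For a lattice ${\bf L}$ of rank $r$ with shortest nonzero vector length $\lambda$ and volume $\mathrm{Vol}({\bf L})$ (square root of the Gram determinant), the center density is $(\lambda/2)^r/\mathrm{Vol}({\bf L})$. *)

(* Defs.v *)
From HB Require Import structures.
From mathcomp Require Import all_boot all_order all_algebra.
From mathcomp Require Import classical_sets reals.

Set Implicit Arguments.
Unset Strict Implicit.
Unset Printing Implicit Defensive.

Import Order.TTheory GRing.Theory Num.Theory.
Local Open Scope classical_set_scope.
Local Open Scope ring_scope.

Definition hamming_weight (N : nat) (c : 'rV['F_2]_N) : nat :=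
  #|[set i | c 0 i != 0]%SET|.

(* [d] is the exact minimum, attained, and not just a lower bound. *)
Definition is_min_weight (N : nat) (C : {vspace 'rV['F_2]_N}) (d : nat) : Prop :=
  (exists c, [/\ c \in C, c != 0 & hamming_weight c = d]) /\
  (forall c, c \in C -> c != 0 -> (d <= hamming_weight c)%N).

Definition is_binary_linear_code (N k d : nat) (C : {vspace 'rV['F_2]_N}) : Prop :=
  (\dim C)%VS = k /\ is_min_weight C d.

(* The library's norm on ['rV[R]_m] is the sup norm, hence this definition. *)
Definition euclidean_norm (R : realType) (m : nat) (x : 'rV[R]_m) : R :=
  Num.sqrt (\sum_(i < m) x 0 i ^+ 2).

Definition integer_span (R : realType) (r m : nat) (B : 'M[R]_(r, m)) :
    set 'rV[R]_m :=
  [set x | exists z : 'rV[int]_r, x = map_mx intr z *m B].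

(* The rows of [B] are a Z-basis of [L] and are linearly independent over R. *)
Definition is_lattice_basis (R : realType) (r m : nat)
    (L : set 'rV[R]_m) (B : 'M[R]_(r, m)) : Prop :=
  row_free B /\ L = integer_span B.

Definition is_lattice (R : realType) (r m : nat) (L : set 'rV[R]_m) : Prop :=
  exists B : 'M[R]_(r, m), is_lattice_basis L B.

Definition is_shortest_length (R : realType) (m : nat)
    (L : set 'rV[R]_m) (lam : R) : Prop :=
  (exists x, [/\ L x, x != 0 & euclidean_norm x = lam]) /\
  (forall x, L x -> x != 0 -> lam <= euclidean_norm x).

(* [B *m B^T] is the Gram matrix of the rows of [B]; its determinant is the
   same for all Z-bases of [L]. *)
Definition is_lattice_volume (R : realType) (r m : nat)
    (L : set 'rV[R]_m) (V : R) : Prop :=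
  exists2 B : 'M[R]_(r, m),
    is_lattice_basis L B & V = Num.sqrt (\det (B *m B^T)).

Definition is_center_density (R : realType) (r m : nat)
    (L : set 'rV[R]_m) (delta : R) : Prop :=
  exists lam V : R,
    [/\ is_shortest_length L lam, is_lattice_volume r L V
      & delta = (lam / 2) ^+ r / V].

(* Main.v *)
Require Import Defs.
From HB Require Import structures.
From mathcomp Require Import all_boot all_order all_algebra.
From mathcomp Require Import classical_sets reals.
From mathcomp Require Import zify ring lra.
From Stdlib Require BinInt.

Import Order.TTheory GRing.Theory Num.Theory.
Local Open Scope ring_scope.

(** Both parts are counting arguments about systematic codes
    [{(u, u M)}] in [F^(k + m)]: if a set [S] of forbidden vectors has fewer
    than [#|F|^m] elements, the rows of [M] can be chosen one after the other
    so that no nonzero codeword lies in [S].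

    For the code, [S] is the set of binary vectors of weight less than 1024 and
    the first row is prescribed so that 1024 is attained; a Chernoff bound with
    weight [1/3] gives [#|S| <= 4^4096 / 3^3073 < 2^3324].

    For the lattice, let [p = 41] and let [S] consist of the residues mod [p]
    of integer vectors of norm less than [p]. Construction A applied to a code
    avoiding [S] gives a lattice of minimal norm exactly [p] and volume [p^m],
    so of center density [p^k / 2^4096]. A Chernoff bound with weight
    [4^(-x^2)] gives [#|S| <= 4^(p^2) * theta^4096], where
    [theta <= 1 + 2 * \sum_(i >= 1) 4^(-(3 i - 2)) = 95/63] and [theta^5 <= 8].
    With [m = 1092] and [k = 3004] this is below [p^m], and [p^3 > 2^16]
    then gives a density of more than [2^11529]. *)

(** * Greedy construction of systematic codes avoiding a set *)

Lemma exists_row_avoiding {F : finFieldType} {k m j : nat}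
    {S : {set 'rV[F]_(k + m)}} {M : 'M[F]_(k, m)} :
  (#|S| < #|F| ^ m)%N -> (j < k)%N ->
  (forall u : 'rV_k, (forall i : 'I_k, (j <= i)%N -> u 0 i = 0) ->
     row_mx u (u *m M) \in S -> u = 0) ->
  exists M' : 'M[F]_(k, m),
    (forall i : 'I_k, (i < j)%N -> row i M' = row i M) /\
    forall u : 'rV_k, (forall i : 'I_k, (j < i)%N -> u 0 i = 0) ->
      row_mx u (u *m M') \in S -> u = 0.
Proof.
move=> cardS ltjk avoid; pose o := Ordinal ltjk.
pose Mo := \matrix_i (if i == o then 0 else row i M).
(* If [lsubmx s] is nonzero at [o], [bad s] is the only row at [o] that makes [s] a codeword; if it
   vanishes there, the inverse is 0 and the value is harmless. *)
pose bad (s : 'rV[F]_(k + m)) : 'rV[F]_m :=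
  (lsubmx s 0 o)^-1 *: (rsubmx s - lsubmx s *m Mo).
have /subsetPn[r _ rP] : ~~ ([set: 'rV[F]_m] \subset [set bad s | s in S]%SET).
  apply/negP => /subset_leq_card.
  rewrite cardsT card_mx mul1n leqNgt => /negP[].
  exact: leq_ltn_trans (leq_imset_card _ _) cardS.
exists (\matrix_i (if i == o then r else row i M)); split.
  move=> i ltij; rewrite rowK; case: eqP => // eio.
  by rewrite eio ltnn in ltij.
move=> u u0; set M' := (\matrix_i _).
have uM' : u *m M' = u *m Mo + u 0 o *: r.
  rewrite !mulmx_sum_row (bigD1 o) //= [in RHS](bigD1 o) //= !rowK eqxx.
  rewrite scaler0 add0r addrC; congr (_ + _).
  by apply: eq_bigr => i /negPf nio; rewrite !rowK nio.
have [uo0|uo0] := eqVneq (u 0 o) 0; last first.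
  move=> inS; case/negP: rP; apply/imsetP; exists (row_mx u (u *m M')) => //.
  by rewrite /bad row_mxKl row_mxKr uM' addrC addKr scalerA mulVf // scale1r.
have uj (i : 'I_k) : (j <= i)%N -> u 0 i = 0.
  rewrite leq_eqVlt => /predU1P[ji|]; last exact: u0.
  by rewrite -uo0; congr (u 0 _); apply: val_inj.
have -> : u *m M' = u *m M.
  rewrite uM' uo0 scale0r addr0 !mulmx_sum_row; apply: eq_bigr => i _.
  by rewrite rowK; case: eqP => // ->; rewrite uo0 !scale0r.
exact: avoid.
Qed.

(* Greedy choice of the rows of [M] from index [j] on: a new row [r] is
   forbidden only if [(u, w) = (u, u M)] for some [(u, w)] in [S] with nonzero
   new coordinate, and each element of [S] forbids at most one [r]. *)
Lemma exists_systematic_avoiding {F : finFieldType} {k m j : nat}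
    {S : {set 'rV[F]_(k + m)}} {M : 'M[F]_(k, m)} :
  (#|S| < #|F| ^ m)%N -> (j <= k)%N ->
  (forall u : 'rV_k, (forall i : 'I_k, (j <= i)%N -> u 0 i = 0) ->
     row_mx u (u *m M) \in S -> u = 0) ->
  exists M' : 'M[F]_(k, m),
    (forall i : 'I_k, (i < j)%N -> row i M' = row i M) /\
    forall u : 'rV_k, row_mx u (u *m M') \in S -> u = 0.
Proof.
move=> cardS.
elim: {j}(k - j)%N {-2}j (leqnn (k - j)) M => [|d IHd] j kj M jk av.
  exists M; split=> // u; apply: av => i ji.
  by have := ltn_ord i; lia.
have [ltjk|lekj] := ltnP j k; last by apply: (IHd j) => //; lia.
have [M1 [M1M av1]] := exists_row_avoiding cardS ltjk av.
have kSj : (k - j.+1 <= d)%N by lia.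
have [M2 [M2M av2]] := IHd _ kSj M1 ltjk av1.
exists M2; split=> // i ij.
by rewrite M2M ?M1M // ltnS ltnW.
Qed.

(** * Product weights and the Chernoff bound *)

Lemma sum_prod_row (R : comNzRingType) (T : finType) (n : nat) (g : T -> R) :
  \sum_(v : 'rV[T]_n) \prod_(i < n) g (v 0 i) = (\sum_a g a) ^+ n.
Proof.
rewrite -[X in _ ^+ X]card_ord -prodr_const bigA_distr_bigA /=.
rewrite (reindex (fun f : {ffun 'I_n -> T} => \row_i f i)) /=; last first.
  exists (fun v => [ffun i => v 0 i]) => [f|v] _.
    by apply/ffunP => i; rewrite ffunE mxE.
  by apply/rowP => i; rewrite mxE ffunE.
by apply: eq_bigr => f _; apply: eq_bigr => i _; rewrite mxE.
Qed.

(* The Chernoff (Markov) bound for a product weight. *)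
Lemma card_mul_le_sum_weight (R : numDomainType) (T : finType) (n : nat)
    (g : T -> R) (c : R) (S : {set 'rV[T]_n}) :
  (forall a, 0 <= g a) ->
  (forall v, v \in S -> c <= \prod_(i < n) g (v 0 i)) ->
  #|S|%:R * c <= (\sum_a g a) ^+ n.
Proof.
move=> g0 gc; rewrite -sum_prod_row mulr_natl -sumr_const.
rewrite (le_trans (ler_sum _ gc)) // [leRHS](bigID (mem S)) /= lerDl.
by apply: sumr_ge0 => v _; apply: prodr_ge0.
Qed.

(** * Binary codes of prescribed minimum weight *)

Lemma hamming_weightE (N : nat) (v : 'rV['F_2]_N) :
  hamming_weight v = (\sum_(i < N) (v 0%R i != 0%R))%N.
Proof. by rewrite /hamming_weight cardsE -sum1_card big_mkcond. Qed.

(** The weight 1/3 is scaled by 3 to stay integral: a zero coordinate counts 3 and a one counts 1.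
    Weight below [d] leaves at least [N.+1 - d] zeros. *)
Lemma card_small_weight (N d : nat) :
  (#|[set v : 'rV['F_2]_N | (hamming_weight v < d)%N]%SET| * 3 ^ (N.+1 - d)
     <= 4 ^ N)%N.
Proof.
pose g (a : 'F_2) : int := if a == 0 then 3 else 1.
have := @card_mul_le_sum_weight int 'F_2 N g (3 ^+ (N.+1 - d))
  [set v : 'rV['F_2]_N | (hamming_weight v < d)%N]%SET.
have -> : \sum_a g a = 4.
  by rewrite big_ord_recl big_ord_recl big_ord0.
move=> H; rewrite -(ler_nat int) natrM !natrX; apply: H => [a|v].
  by rewrite /g; case: ifP.
rewrite inE => wv.
have -> : \prod_(i < N) g (v 0 i) = 3 ^+ #|[pred i | v 0 i == 0]|.
  by rewrite -prodr_const [RHS]big_mkcond.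
apply: ler_weXn2l => //.
suff : (#|[pred i | v 0%R i == 0%R]| + hamming_weight v)%N = N by lia.
rewrite -[RHS]card_ord -(cardC [pred i | v 0 i == 0]); congr (_ + _)%N.
by rewrite /hamming_weight cardsE; apply: eq_card => i; rewrite !inE.
Qed.

Lemma dim_systematic_code (F : fieldType) (k m : nat) (M : 'M[F]_(k, m)) :
  \dim (limg (linfun (mulmxr (row_mx 1%:M M)) : 'Hom('rV[F]_k, 'rV[F]_(k + m))))
    = k.
Proof.
rewrite limg_dim_eq; first by rewrite dimvf /dim /= mul1n.
apply/eqP; rewrite capfv -subv0; apply/subvP => u.
rewrite memv_ker lfunE /= mul_mx_row mulmx1 => /eqP H.
have: lsubmx (row_mx u (u *m M)) = lsubmx (0 : 'rV_(k + m)) by rewrite H.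
by rewrite row_mxKl linear0 => ->; rewrite memv0.
Qed.

Lemma gilbert_varshamov_code (N k m d : nat) : N = (k.+1 + m)%N ->
  (0 < d)%N -> (d <= m.+1)%N -> (4 ^ N < 2 ^ m * 3 ^ (N.+1 - d))%N ->
  exists C : {vspace 'rV['F_2]_N}, is_binary_linear_code k.+1 d C.
Proof.
move=> -> d0 dm lt4.
set S := [set v : 'rV['F_2]_(k.+1 + m) | (hamming_weight v < d)%N]%SET.
have cardS : (#|S| < #|'F_2| ^ m)%N.
  have := leq_ltn_trans (card_small_weight _ d) lt4.
  by rewrite ltn_mul2r card_Fp // => /andP[].
(* Row 0 has [d.-1] ones, which fit since [d <= m.+1]; the systematic coordinate supplies the last
   one. Only row 0 is kept: the greedy choice starts at index 1. *)
pose M0 : 'M['F_2]_(k.+1, m) := \matrix_(i, j) (j < d.-1)%:R.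
have wt0 : hamming_weight (row_mx (delta_mx 0 0 : 'rV_k.+1) (row 0 M0)) = d.
  rewrite hamming_weightE big_split_ord /= (bigD1 0) //= row_mxEl mxE /=.
  rewrite big1 => [|i /negPf ni]; last by rewrite row_mxEl mxE ni andbF eqxx.
  rewrite addn0.
  under eq_bigr => i _ do rewrite row_mxEr !mxE.
  transitivity (1 + d.-1)%N; last by rewrite add1n prednK.
  congr (_ + _)%N.
  transitivity (\sum_(i < m | (i < d.-1)%N) 1)%N.
    by rewrite [RHS]big_mkcond; apply: eq_bigr => i _; case: ifP.
  rewrite -(big_ord_widen m (fun=> 1%N)); last by lia.
  by rewrite sum1_card card_ord.
have one (u : 'rV['F_2]_k.+1) : (forall i : 'I_k.+1, (1 <= i)%N -> u 0 i = 0) ->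
    u = u 0 0 *: (delta_mx 0 0 : 'rV['F_2]_k.+1).
  move=> u0; apply/rowP => i; rewrite !mxE /=.
  by case: (unliftP 0 i) => [i'|] -> ; rewrite /= ?mulr0 ?mulr1 // u0.
have [|M [M0M av]] := @exists_systematic_avoiding _ _ _ 1 _ M0 cardS isT.
  move=> u /one ->; set a := u 0 0.
  have [->|a0] := eqVneq a 0; first by rewrite scale0r.
  have -> : a = 1 by move: a a0 => [[|[|]]] //= *; apply: val_inj.
  by rewrite scale1r -rowE inE wt0 ltnn.
exists (limg (linfun (mulmxr (row_mx 1%:M M)))); split.
  exact: dim_systematic_code.
split.
  exists (row_mx (delta_mx 0 0) (row 0 M0)); split=> //.
    apply/memv_imgP; exists (delta_mx 0 0); rewrite ?memvf //.
    by rewrite lfunE /= mul_mx_row mulmx1 -rowE M0M.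
  apply/eqP => H; move: wt0; rewrite H hamming_weightE big1; first by lia.
  by move=> i _; rewrite mxE eqxx.
move=> c /memv_imgP[u _ ->]; rewrite lfunE /= mul_mx_row mulmx1 leqNgt.
by apply: contraNN => lt; rewrite (av u) ?mul0mx ?row_mx0 // inE.
Qed.

(** * Counting residues of short integer vectors *)

(** For prime [p], the least absolute value of an integer in the residue class [a]. *)
Definition Fp_abs (p : nat) (a : 'F_p) : nat := minn a (p - a).

Lemma Fp_abs_intr_le (p : nat) (x : int) : prime p ->
  (Fp_abs p x%:~R <= `|x|)%N.
Proof.
move=> p_pr; have p0 := prime_gt0 p_pr.
have le_nat (n : nat) : (Fp_abs p n%:R <= n)%N.
  by rewrite /Fp_abs val_Fp_nat // geq_min leq_mod.
have absN (a : 'F_p) : Fp_abs p (- a) = Fp_abs p a.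
  rewrite /Fp_abs /=; move: (nat_of_ord a) (ltn_ord a) => {}a.
  rewrite Fp_cast // => ltap.
  have [->|a0] := posnP a; first by rewrite subn0 modnn !min0n.
  by rewrite modn_small; lia.
case: (intP x) => [|n|n]; first exact: le_nat.
  exact: le_nat.
by rewrite rmorphN absN abszN; apply: le_nat.
Qed.

(** As [(i + 1)^2 >= 3 i + 1], a geometric series of ratio 1/64 dominates; its exact partial sum on
    the right makes the induction close. *)
Lemma sum_exprn_sqr_le (R : realFieldType) (n : nat) :
  \sum_(0 <= i < n) (4^-1 : R) ^+ (i.+1 ^ 2) <= 16 / 63 * (1 - 4^-1 ^+ (3 * n)).
Proof.
elim: n => [|n IHn]; first by rewrite big_nil muln0 expr0 subrr mulr0.
rewrite big_nat_recr //=.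
have le1 : (4^-1 : R) ^+ (n.+1 ^ 2) <= 4^-1 ^+ (3 * n).+1.
  by rewrite ler_wiXn2l ?invr_ge0 ?invf_le1 ?ler1n //; nia.
rewrite mulnS exprD; rewrite exprS in le1.
by move: IHn le1; set u := \sum_(_ <= _ < _) _; set v := _ ^+ (n.+1 ^ 2);
   set w := _ ^+ (3 * n); rewrite !exprS expr0; lra.
Qed.

Lemma theta_Fp_le (R : realFieldType) (p : nat) : prime p ->
  \sum_(a : 'F_p) (4^-1 : R) ^+ (Fp_abs p a ^ 2) <= 95 / 63.
Proof.
move=> p_pr.
rewrite -(big_mkord xpredT (fun i => (4^-1 : R) ^+ (minn i (p - i) ^ 2))).
rewrite Fp_cast //; have := prime_gt0 p_pr; case: p {p_pr} => // p _.
(* From here on [p] is the modulus minus one; the residue 0 contributes 1. *)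
rewrite big_nat_recl //= min0n expr0.
pose c i : R := 4^-1 ^+ (i.+1 ^ 2).
have c0 i : 0 <= c i by rewrite exprn_ge0 ?invr_ge0.
(* Each term is [c i] or [c (p - i.+1)]. Both families have the same sum by reflection, whence
   [1 + 2 * 16/63 = 95/63]. *)
have : \sum_(0 <= i < p) (4^-1 : R) ^+ (minn i.+1 (p.+1 - i.+1) ^ 2)
    <= \sum_(0 <= i < p) (c i + c (p - i.+1)%N).
  rewrite !big_nat; apply: ler_sum => i /andP[_ ip].
  rewrite subSS /minn; case: ifP => _; first by rewrite lerDl.
  by rewrite -[(p - i)%N]prednK ?subn_gt0 // -subnS lerDr.
have cle : \sum_(0 <= i < p) c i <= 16 / 63.
  apply: le_trans (sum_exprn_sqr_le R p) _.
  have : 0 <= (4^-1 : R) ^+ (3 * p) by rewrite exprn_ge0 ?invr_ge0.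
  by lra.
have : \sum_(0 <= i < p) c (p - i.+1)%N = \sum_(0 <= i < p) c i.
  by rewrite [RHS]big_nat_rev.
by rewrite big_split /=; lra.
Qed.

(* The residues mod [p] of the integer vectors of norm less than [p]. *)
Definition short_vectors (p N : nat) : {set 'rV['F_p]_N} :=
  [set v : 'rV['F_p]_N | (\sum_(i < N) Fp_abs p (v 0%R i) ^ 2 < p ^ 2)%N]%SET.

Lemma card_short_vectors (R : realFieldType) (p N : nat) : prime p ->
  #|short_vectors p N|%:R <= 4 ^+ (p ^ 2) * (95 / 63) ^+ N :> R.
Proof.
move=> p_pr; have c0 n : 0 <= (4^-1 : R) ^+ n by rewrite exprn_ge0 ?invr_ge0.
rewrite mulrC -ler_pdivrMr ?exprn_gt0 // -exprVn.
pose theta : R := \sum_(a : 'F_p) 4^-1 ^+ (Fp_abs p a ^ 2).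
apply: le_trans (_ : theta ^+ N <= _).
  apply: card_mul_le_sum_weight => // v; rewrite inE => /ltnW vS.
  by rewrite -expr_sum ler_wiXn2l ?invr_ge0 ?invf_le1 ?ler1n.
apply: lerXn2r; rewrite ?nnegrE ?theta_Fp_le //; first exact: sumr_ge0.
by rewrite divr_ge0.
Qed.

(** * Construction A *)

Lemma euclidean_norm_intr (R : realType) (N : nat) (y : 'rV[int]_N) :
  euclidean_norm (map_mx intr y : 'rV[R]_N) =
    Num.sqrt (\sum_(i < N) `|y 0%R i| ^ 2)%N%:R.
Proof.
congr Num.sqrt; rewrite natr_sum; apply: eq_bigr => i _.
by rewrite mxE natrX natr_absz intr_norm real_normK ?num_real.
Qed.

Lemma construction_A_lattice (R : realType) (p k m : nat) :
  prime p -> (0 < m)%N -> (#|short_vectors p (k + m)| < p ^ m)%N ->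
  exists L : set 'rV[R]_(k + m), is_lattice (k + m) L /\
    is_center_density (k + m) L ((p%:R / 2) ^+ (k + m) / p%:R ^+ m).
Proof.
move=> p_pr m0 cardS; have p0 := prime_gt0 p_pr.
have [||M [_ av]] := @exists_systematic_avoiding
  _ _ _ 0 (short_vectors p (k + m)) 0 _ isT.
- by rewrite card_Fp.
- by move=> u u0 _; apply/rowP => i; rewrite u0 // mxE.
pose Mz : 'M[int]_(k, m) := map_mx (fun a : 'F_p => (a : nat)%:Z) M.
(* The integer span of these rows consists of the integer vectors that reduce mod [p] to
   codewords. *)
pose Bz : 'M[int]_(k + m) := block_mx 1%:M Mz 0 (p%:Z)%:M.
pose B : 'M[R]_(k + m) := map_mx intr Bz.
have detB : \det B = p%:R ^+ m.
  by rewrite det_map_mx det_ublock det1 mul1r det_scalar rmorphXn.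
have basisB : is_lattice_basis (integer_span B) B.
  split=> //; rewrite row_free_unit unitmxE detB unitfE.
  by rewrite expf_neq0 // pnatr_eq0 -lt0n.
exists (integer_span B); split; first by exists B.
exists p%:R, (p%:R ^+ m); split=> //; last first.
  exists B => //; rewrite det_mulmx det_tr detB -expr2 sqrtr_sqr ger0_norm //.
  exact: exprn_ge0.
have normp (y : 'rV[int]_(k + m)) : (p ^ 2 <= \sum_i `|y 0%R i| ^ 2)%N ->
    p%:R <= euclidean_norm (map_mx intr y : 'rV[R]_(k + m)).
  move=> py; rewrite euclidean_norm_intr -[leLHS]ger0_norm // -sqrtr_sqr.
  by rewrite ler_wsqrtr // -natrX ler_nat.
split.
  (* The norm [p] is attained at [p] times a unit vector of the last [m] coordinates. *)
  pose o := Ordinal m0; pose z0 : 'rV[int]_(k + m) := row_mx 0 (delta_mx 0 o).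
  pose y := z0 *m Bz.
  have yE : y = p%:Z *: delta_mx 0 (rshift k o).
    rewrite /y /z0 mul_row_block !mul0mx add0r mulmx0 add0r mul_mx_scalar.
    apply/rowP => i; case: (split_ordP i) => j ->.
      by rewrite row_mxEl !mxE eq_lrshift andbF mulr0.
    by rewrite row_mxEr !mxE eq_rshift.
  have y1 (i : 'I_(k + m)) : y 0 i = if i == rshift k o then p%:Z else 0.
    by rewrite yE !mxE /=; case: (i == _); rewrite ?mulr1 ?mulr0.
  exists (map_mx intr y); split.
  - by exists z0; rewrite map_mxM.
  - apply/eqP => /rowP/(_ (rshift k o)); rewrite mxE y1 eqxx mxE /=.
    by move/eqP; rewrite pnatr_eq0 => /eqP p00; rewrite p00 in p0.
  - rewrite euclidean_norm_intr (bigD1 (rshift k o)) //= y1 eqxx big1.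
      by rewrite addn0 natrX sqrtr_sqr ger0_norm.
    by move=> i /negPf ni; rewrite y1 ni.
move=> _ [z ->]; rewrite -map_mxM; set y := z *m Bz => y0; apply: normp.
pose r : 'rV_(k + m) -> 'rV['F_p]_(k + m) := map_mx intr.
have ry : r y = row_mx (map_mx intr (lsubmx z)) (map_mx intr (lsubmx z) *m M).
  rewrite /r map_mxM -{1}[z]hsubmxK map_row_mx map_block_mx mul_row_block.
  rewrite map_mx1 map_mx0 map_scalar_mx /= -pmulrn pchar_Fp_0 //.
  rewrite mulmx1 mulmx0 mul_mx_scalar scale0r !addr0 -map_mx_comp /=.
  congr (row_mx _ (_ *m _)).
  by apply/matrixP => i j; rewrite mxE /= -pmulrn natr_Zp.
(* Outside [short_vectors], the residues alone force norm at least [p]. Inside, the codeword [r y]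
   must be 0, so [y] has a nonzero coordinate divisible by [p]. *)
have [inS|] := boolP (r y \in short_vectors p (k + m)); last first.
  rewrite inE -leqNgt => /leq_trans; apply; apply: leq_sum => i _.
  by rewrite mxE leq_sqr Fp_abs_intr_le.
have ry0 : r y = 0.
  by rewrite ry in inS *; rewrite (av _ inS) mul0mx row_mx0.
have /rV0Pn[i yi0] : y != 0.
  by apply: contraNneq y0 => ->; rewrite map_mx0.
rewrite (bigD1 i) //= (leq_trans _ (leq_addr _ _)) // leq_sqr dvdn_leq //.
  by rewrite absz_gt0.
rewrite (dvdn_pcharf (pchar_Fp p_pr)).
move/rowP/(_ i): ry0; rewrite mxE [RHS]mxE => /eqP.
by case: (y 0 i) => n; rewrite ?NegzE ?abszN ?rmorphN /= ?oppr_eq0 -pmulrn.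
Qed.

(** * Numerical estimates and choice of parameters *)

(** All factors are compared with powers of 2: [(95/63)^5 <= 2^3], the one leftover factor is at
    most 2, and [p^3 > 2^c]. *)
Lemma card_short_vectors_lt (R : realFieldType) (p a b c : nat) : prime p ->
  (2 ^ c < p ^ 3)%N -> (2 * p ^ 2 + (3 * a).+1 < c * b)%N ->
  (#|short_vectors p (5 * a).+1| < p ^ (3 * b))%N.
Proof.
move=> p_pr cp3 lt_ab; rewrite -(ltr_nat R).
apply: le_lt_trans (card_short_vectors R _ _ p_pr) _.
have le8 : (95 / 63 : R) ^+ (5 * a).+1 <= 2 ^+ (3 * a).+1.
  rewrite !exprS !exprM; apply: ler_pM; rewrite ?exprn_ge0 ?divr_ge0 //.
    by lra.
  by apply: lerXn2r; rewrite ?nnegrE ?exprn_ge0 ?divr_ge0 //; lra.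
apply: le_lt_trans (_ : 2 ^+ (2 * p ^ 2 + (3 * a).+1) < _).
  have -> : 4 = 2 ^+ 2 :> R by ring.
  by rewrite exprD exprM; apply: ler_wpM2l; rewrite ?exprn_ge0.
rewrite -natrX ltr_nat; apply: leq_trans (_ : 2 ^ (c * b) <= _)%N.
  by rewrite ltn_exp2l.
by rewrite !expnM leq_exp2r ?(ltnW cp3) //; case: b lt_ab => //; rewrite muln0.
Qed.

(** The density is [p^k / 2^N]; rounding [k] down to a multiple of 3 makes [p^3 > 2^c]
    applicable. *)
Lemma le_exprn2_center_density (R : realType) (p c k m N e : nat) :
  (0 < p)%N -> N = (k + m)%N -> (2 ^ c < p ^ 3)%N ->
  (e + N <= c * (k %/ 3))%N ->
  2 ^+ e <= (p%:R / 2) ^+ N / p%:R ^+ m :> R.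
Proof.
move=> p0 Nkm cp3 eN; have pR0 : 0 < p%:R :> R by rewrite ltr0n.
rewrite ler_pdivlMr ?exprn_gt0 // expr_div_n ler_pdivlMr ?exprn_gt0 //.
rewrite mulrAC -exprD [in leRHS]Nkm [leRHS]exprD ler_pM2r ?exprn_gt0 //.
rewrite -!natrX ler_nat.
apply: leq_trans (_ : 2 ^ (c * (k %/ 3)) <= _)%N; first by rewrite leq_exp2l.
apply: leq_trans (_ : p ^ (3 * (k %/ 3)) <= _)%N.
  rewrite !expnM; case: (k %/ 3)%N => // b.
  by rewrite leq_exp2r // ltnW.
by rewrite leq_pexp2l // mulnC leq_trunc_div.
Qed.

(* Reduces the comparison of huge unary numbers to binary arithmetic. *)
Lemma ltn_exp_Zltb (a b c d : nat) :
  BinInt.Z.ltb (BinInt.Z.pow (BinInt.Z.of_nat a) (BinInt.Z.of_nat c))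
    (BinInt.Z.pow (BinInt.Z.of_nat b) (BinInt.Z.of_nat d)) ->
  (a ^ c < b ^ d)%N.
Proof. lia. Qed.

Lemma ltn_exp4_mul_exp2_exp3 (n m c j : nat) :
  (2 * n <= m + c)%N -> (2 ^ c < 3 ^ j)%N -> (4 ^ n < 2 ^ m * 3 ^ j)%N.
Proof.
move=> nmc lt23; rewrite -[4%N]/(2 ^ 2)%N -expnM.
apply: leq_ltn_trans (_ : 2 ^ (m + c) < _)%N; first by rewrite leq_exp2l.
by rewrite expnD ltn_pmul2l ?expn_gt0.
Qed.

Lemma exists_dense_lattice (R : realType) (N k m a b p c e : nat) :
  N = (k + m)%N -> N = (5 * a).+1 -> m = (3 * b)%N -> prime p ->
  (2 ^ c < p ^ 3)%N -> (2 * p ^ 2 + (3 * a).+1 < c * b)%N ->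
  (e + N <= c * (k %/ 3))%N ->
  exists L : set 'rV[R]_N, is_lattice N L /\
    exists delta : R, is_center_density N L delta /\ 2 ^+ e <= delta.
Proof.
move=> -> Na mb p_pr cp3 lt_ab eN; have m0 : (0 < m)%N by lia.
have := card_short_vectors_lt R p a b c p_pr cp3 lt_ab.
rewrite -Na -mb => cardS.
have [L [L_lat densL]] := construction_A_lattice R p k m p_pr m0 cardS.
exists L; split=> //; exists ((p%:R / 2) ^+ (k + m) / p%:R ^+ m); split=> //.
exact: (le_exprn2_center_density _ _ c k) (prime_gt0 p_pr) _ cp3 eN.
Qed.

Local Open Scope classical_set_scope.

Theorem theorem6p1 (R : realType) :
  (exists C : {vspace 'rV['F_2]_4096}, is_binary_linear_code 772 1024 C) /\
  (exists L : set 'rV[R]_4096,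
     is_lattice 4096 L /\
     exists delta : R, is_center_density 4096 L delta /\ 2 ^+ 11529 <= delta).
Proof.
split.
  apply: (gilbert_varshamov_code _ 771 3324).
  - by apply/eqP; vm_compute.
  - by [].
  - by vm_compute.
  (* [2 * 4096 = 3324 + 4868], and [2^4868 < 3^3073] with [3073 = 4097 - 1024]. *)
  - apply: (ltn_exp4_mul_exp2_exp3 _ _ 4868).
      by vm_compute.
    by apply: ltn_exp_Zltb; vm_compute.
(* 41 is the least prime with cube above [2^16]. The two exponent conditions read [5820 < 5824] and
   [15625 <= 16016]. *)
apply: (exists_dense_lattice R _ 3004 1092 819 364 41 16).
- by apply/eqP; vm_compute.
- by apply/eqP; vm_compute.
- by apply/eqP; vm_compute.
- by vm_compute.
- by apply: ltn_exp_Zltb; vm_compute.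
- by vm_compute.
- by vm_compute.
Qed.
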